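(* Let $\varphi:\mathcal{C}\Omega\to\mathbb{R}$ be a measurable function. The following are equivalent: (i) there exists $q>1$ such that $\displaystyle\sup_{p\in(1,q)}\operatorname{Tail}_s^p(\varphi,\mathcal{C}\Omega;\cdot)\in L^1(\Omega)$; (ii) there exists $q>1$ such that $\displaystyle\sup_{p\in(1,q)}\|\operatorname{Tail}_s^p(\varphi,\mathcal{C}\Omega;\cdot)\|_{L^1(\Omega)}<\infty$; (iii) there exists $q>1$ such that $\operatorname{Tail}_s^1(\varphi,\mathcal{C}\Omega;\cdot)\in L^1(\Omega)$ and $\operatorname{Tail}_s^q(\varphi,\mathcal{C}\Omega;\cdot)\in L^1(\Omega)$.
   Context: Throughout, $\Omega\subset\mathbb{R}^n$ is a bounded open set with Lipschitz boundary, $s\in(0,1)$, and $\mathcal{C}\Omega:=\mathbb{R}^n\setminus\Omega$. For $q\in[1,\infty)$ and $x\in\Omega$, $\operatorname{Tail}_s^q(\varphi,\mathcal{C}\Omega;x):=\int_{\mathcal{C}\Omega}\frac{|\varphi(y)|^q}{|x-y|^{n+sq}}\,dy$. In (i), the supremum is taken pointwise in $x\in\Omega$. *)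

(* Defs.v *)
From HB Require Import structures.
From mathcomp Require Import all_boot all_order all_algebra.
From mathcomp Require Import all_classical all_reals all_analysis.

Set Implicit Arguments.
Unset Strict Implicit.
Unset Printing Implicit Defensive.

Import Order.TTheory GRing.Theory Num.Theory.
Import numFieldTopology.Exports numFieldNormedType.Exports.

Local Open Scope classical_set_scope.
Local Open Scope ring_scope.

Section measurable_rV.
Context d (T : measurableType d) (n : nat).

Let coords : 'I_n -> 'rV[T]_n -> T := fun i x => x ord0 i.

Let rV_set0 : g_sigma_preimage coords set0.
Proof. exact: sigma_algebra0. Qed.

Let rV_setC A : g_sigma_preimage coords A -> g_sigma_preimage coords (~` A).
Proof. exact: sigma_algebraC. Qed.

Let rV_bigcup (F : _^nat) : (forall i, g_sigma_preimage coords (F i)) ->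
  g_sigma_preimage coords (\bigcup_i (F i)).
Proof. exact: sigma_algebra_bigcup. Qed.

HB.instance Definition _ := @isMeasurable.Build (measure_tuple_display d)
  'rV[T]_n (g_sigma_preimage coords) rV_set0 rV_setC rV_bigcup.

Lemma measurable_rV_coord (i : 'I_n) :
  measurable_fun [set: 'rV[T]_n] (fun x : 'rV[T]_n => x ord0 i).
Proof.
move=> _ Y mY; rewrite setTI; apply: sub_sigma_algebra => /=.
rewrite -bigcup_seq/=; exists i => /=; first by rewrite mem_index_enum.
by exists Y => //; rewrite setTI.
Qed.

Lemma measurable_fun_rV d' (S : measurableType d') (f : S -> 'rV[T]_n) :
  (forall i, measurable_fun [set: S] (fun s => f s ord0 i)) ->
  measurable_fun [set: S] f.
Proof.
move=> mf _ A mA; rewrite setTI.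
suff : g_sigma_preimage coords `<=` [set B | measurable (f @^-1` B)] by apply.
apply: smallest_sub.
  split => /=.
  - by rewrite preimage_set0.
  - by move=> B mB; rewrite setTD preimage_setC; exact: measurableC.
  - by move=> F mF; rewrite preimage_bigcup; exact: bigcup_measurable.
move=> B; rewrite -bigcup_seq => -[i _ [C mC <-]] /=.
rewrite setTI -[X in measurable X]setTI.
exact: (mf i).
Qed.

End measurable_rV.

Section borel_lebesgue.
Variable R : realType.
Notation E := (measurableTypeR R).

Definition rV_cons n (p : E * 'rV[E]_n) : 'rV[E]_n.+1 :=
  row_mx (\row_(_ < 1) p.1) p.2.

Lemma measurable_rV_cons n : measurable_fun [set: E * 'rV[E]_n] (@rV_cons n).
Proof.
apply: measurable_fun_rV => i.
have -> : (fun p => @rV_cons n p ord0 i) =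
   (fun p : E * 'rV[E]_n =>
     if @fintype.split 1 n i is inr j then p.2 ord0 j else p.1).
  apply/funext => p; rewrite /rV_cons mxE.
  by case: (fintype.split _) => // j; rewrite mxE.
case: (fintype.split (i : 'I_(1 + n))) => [_|j]; first exact: measurable_fst.
apply: (@measurableT_comp _ _ _ _ _ _ (fun x : 'rV[E]_n => x ord0 j)).
  exact: measurable_rV_coord.
exact: measurable_snd.
Qed.

Definition rV_uncons n (x : 'rV[E]_n.+1) : E * 'rV[E]_n :=
  (x ord0 ord0, \row_j x ord0 (lift ord0 j)).

Lemma rV_consK n : cancel (@rV_cons n) (@rV_uncons n).
Proof.
move=> [a v]; rewrite /rV_uncons /rV_cons /=; congr pair.
  rewrite -[RHS](_ : (\row_(_ < 1) a) ord0 ord0 = a); last by rewrite mxE.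
  rewrite -(row_mxEl (\row_(_ < 1) a) v).
  by congr (row_mx _ _ _ _); exact/val_inj.
apply/rowP => j; rewrite mxE -(row_mxEr (\row_(_ < 1) a) v).
by congr (row_mx _ _ _ _); exact/val_inj.
Qed.

Lemma measurable_rV_uncons n : measurable_fun [set: 'rV[E]_n.+1] (@rV_uncons n).
Proof.
apply/measurable_fun_pairP; split; first exact: measurable_rV_coord.
apply: measurable_fun_rV => j /=.
under [X in measurable_fun _ X]eq_fun do rewrite mxE.
exact: measurable_rV_coord.
Qed.

Section cons.
Context n (mu : {sigma_finite_measure set 'rV[E]_n -> \bar R}).

Definition lebesgue_rV_cons : set 'rV[E]_n.+1 -> \bar R :=
  pushforward (lebesgue_measure \x mu)%E (@rV_cons n).

HB.instance Definition _ := Measure.copy lebesgue_rV_cons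
  (measure_function_pushforward__canonical__measure_function_Measure
    (lebesgue_measure \x mu)%E (@measurable_rV_cons n)).

Let lebesgue_rV_cons_sigma_finite : sigma_finite setT lebesgue_rV_cons.
Proof.
have /sigma_finiteP[F [TF ndF Foo]] :=
  sigma_finiteT (@lebesgue_measure R : {sigma_finite_measure set E -> \bar R}).
have /sigma_finiteP[G [TG ndG Goo]] := sigma_finiteT mu.
exists (fun k => @rV_uncons n @^-1` (F k `*` G k)).
  rewrite -preimage_bigcup -[LHS](preimage_setT (@rV_uncons n)); congr preimage.
  apply/esym/seteqP; split=> // -[x y] _.
  have [i _ Fix] : (\bigcup_i F i) x by rewrite -TF.
  have [j _ Gjy] : (\bigcup_i G i) y by rewrite -TG.
  exists (maxn i j) => //; split => /=.
    by move: x Fix; exact/subsetPset/ndF/leq_maxl.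
  by move: y Gjy; exact/subsetPset/ndG/leq_maxr.
move=> k; have [mF Fkoo] := Foo k; have [mG Gkoo] := Goo k; split.
  rewrite -[X in measurable X]setTI; apply: measurable_rV_uncons => //.
  exact: measurableX.
rewrite /lebesgue_rV_cons /pushforward -comp_preimage.
suff -> : @rV_uncons n \o @rV_cons n = id.
  by rewrite product_measure1E// lte_mul_pinfty// ge0_fin_numE.
exact/funext/rV_consK.
Qed.

HB.instance Definition _ := Measure_isSigmaFinite.Build _ _ _ lebesgue_rV_cons
  lebesgue_rV_cons_sigma_finite.
End cons.

Fixpoint borel_lebesgue_rV n : {sigma_finite_measure set 'rV[E]_n -> \bar R} :=
  if n is m.+1 then lebesgue_rV_cons (borel_lebesgue_rV m) else dirac (0 : 'rV[E]_0).

Lemma borel_lebesgue_rV_box n (A : 'I_n -> set E) :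
  (forall i, measurable (A i)) ->
  borel_lebesgue_rV n [set x | forall i, A i (x ord0 i)] =
  (\prod_(i < n) lebesgue_measure (A i))%E.
Proof.
elim: n A => [|n IHn] A mA.
  by rewrite big_ord0 /= diracE mem_set// => -[].
rewrite big_ord_recl -IHn; last by move=> i; exact: mA.
set B := [set x : 'rV[E]_n | forall i, A (lift ord0 i) (x ord0 i)].
have mB : measurable B.
  rewrite (_ : B = \bigcap_(i in [set: 'I_n])
      ((fun x : 'rV[E]_n => x ord0 i) @^-1` A (lift ord0 i))).
    apply: fin_bigcap_measurable => // i _.
    by rewrite -[X in measurable X]setTI; exact: measurable_rV_coord.
  by apply/seteqP; split=> x Bx i //=; exact: Bx.
rewrite -product_measure1E//; congr ((lebesgue_measure \x _)%E _).
apply/seteqP; split=> [[a v] /= Aav|[a v] /= [Aa Bv] i].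
  have [ea ev] := congr2 pair (congr1 fst (rV_consK (a, v)))
    (congr1 snd (rV_consK (a, v))).
  split; first by rewrite -ea; exact: Aav.
  by move=> i; rewrite -ev mxE; exact: Aav.
have [ea ev] := congr2 pair (congr1 fst (rV_consK (a, v)))
  (congr1 snd (rV_consK (a, v))).
case: (unliftP ord0 i) => [j|] ->; last by move: Aa; rewrite -{1}ea.
by have := Bv j; rewrite -{1}ev mxE.
Qed.

(* n-dimensional Lebesgue measurable sets: the Caratheodory sigma-algebra, i.e.
   the completion of the Borel sigma-algebra *)
Definition lebesgue_space n : measurableType _ :=
  caratheodory_type ((borel_lebesgue_rV n)^*)%mu.

Definition lebesgue_rV n : set (lebesgue_space n) -> \bar R :=
  @completed_measure_extension _ _ R (borel_lebesgue_rV n).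

HB.instance Definition _ n := Measure.on (@lebesgue_rV n).

Let lebesgue_rV_sigma_finite n : sigma_finite setT (@lebesgue_rV n).
Proof. exact/completed_measure_extension_sigma_finite/sigma_finiteT. Qed.

HB.instance Definition _ n := Measure_isSigmaFinite.Build _ _ _
  (@lebesgue_rV n) (@lebesgue_rV_sigma_finite n).

End borel_lebesgue.
Arguments lebesgue_rV {R n}.

Section euclidean.
Context {R : realType}.

(* the library norm on 'rV[R]_n is the sup norm *)
Definition enorm n (x : 'rV[R]_n) : R := Num.sqrt (\sum_(i < n) x ord0 i ^+ 2).

Definition boundary (T : topologicalType) (A : set T) : set T :=
  closure A `\` interior A.

(* Near each boundary point, after an orthogonal change x *m Q of coordinates,
   A is the set of points lying strictly on one side of the graph of a
   Lipschitz function of the coordinates other than the i-th. *)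
Definition lipschitz_boundary n (A : set 'rV[R]_n) : Prop :=
  forall z, boundary A z ->
  exists (Q : 'M[R]_n) (i : 'I_n) (g : 'rV[R]_n.-1 -> R),
    [/\ Q *m Q^T = 1%:M, lipschitz g &
        \forall x \near z, A x <-> g (col' i (x *m Q)) < (x *m Q) ord0 i].

Definition Tail n (s q : R) (phi : 'rV[R]_n -> R) (A : set 'rV[R]_n)
    (x : 'rV[R]_n) : \bar R :=
  (\int[@lebesgue_rV R n]_(y in A)
     (`|phi y| `^ q / enorm (x - y) `^ (n%:R + s * q))%:E)%E.

End euclidean.

(* Main.v *)
Require Import Defs.
From mathcomp Require Import all_boot all_order all_algebra.
From mathcomp Require Import all_classical all_reals all_analysis.
From mathcomp Require Import measurable_realfun ring.

Set Implicit Arguments.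
Unset Strict Implicit.
Unset Printing Implicit Defensive.

Import Order.TTheory GRing.Theory Num.Theory.
Import numFieldTopology.Exports numFieldNormedType.Exports.

Local Open Scope classical_set_scope.
Local Open Scope ring_scope.

(** The integrand of the tail of order [p] is [u ^ p / d ^ n] with
    [d = |x - y|] and [u = |phi y| / d ^ s]. As a function of [p] it is
    zero for [u = 0] and an exponential otherwise, which gives two facts: it is continuous on [p > 0]
    ([continuous_power_kernel]), and for [1 <= p <= q] it is at most the sum of
    its values at [1] and [q] ([power_kernel_le]), since [u ^ p <= u] when
    [u <= 1] and [u ^ p <= u ^ q] when [u >= 1].

    The equivalence holds for every nonnegative jointly measurable kernel with
    these two properties ([sup_integrable_tfae]).
    - (i) implies (ii) because each tail lies below the pointwise supremum.
    - (ii) implies (iii): let [p] decrease to [1] along a sequence. Continuity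
      of the kernel and Fatou's lemma in [y] give
      [Tail 1 x <= liminf (Tail p_k x)], and Fatou's lemma in [x] bounds the
      integral of [Tail 1] by the supremum in (ii). The second exponent can be
      any point strictly between [1] and the [q] of (ii).
    - (iii) implies (i): integrating the pointwise bound in [y] shows that the
      supremum is at most [Tail 1 + Tail q].

    The delicate point in (i) is the measurability of a supremum over an
    uncountable set of exponents. Fatou's lemma in [y] also says that
    [p |-> Tail p x] is lower semicontinuous, so the supremum may be taken over
    rational exponents ([measurable_S]).

    It remains to see that open sets and the Euclidean distance are measurable
    for the Lebesgue sigma-algebra: an open set is a countable union of balls of
    the sup norm with rational centers ([open_rV_bigcup_ball]), and such a ball
    is a box. *)

(** * Fatou's lemma and sequences of exponents *)

Lemma limn_einf_le (R : realType) (u : (\bar R)^nat) (c : \bar R) :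
  (forall k, u k <= c)%E -> (limn_einf u <= c)%E.
Proof.
move=> uc; rewrite limn_einf_lim; apply: lime_le; first exact: is_cvg_einfs.
apply: nearW => k; apply: le_trans (uc k).
by apply: ereal_inf_lbound; exists k => /=.
Qed.

(** A form of Fatou's lemma that asks for no convergence, only for a lower bound
    of the inferior limit: the tails of order [p_k] are not known to converge
    to the tail of order [1]. *)
Lemma le_fatou d (T : measurableType d) (R : realType)
    (mu : {measure set T -> \bar R}) (D : set T) (mD : measurable D)
    (f : (T -> \bar R)^nat) (g : T -> \bar R) :
  (forall k, measurable_fun D (f k)) ->
  (forall k x, D x -> (0 <= f k x)%E) ->
  measurable_fun D g -> (forall x, D x -> (0 <= g x)%E) ->
  (forall x, D x -> (g x <= limn_einf (f ^~ x))%E) ->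
  (\int[mu]_(x in D) g x <= limn_einf (fun k => \int[mu]_(x in D) f k x))%E.
Proof.
move=> mf f0 mg g0 fg; apply: le_trans (fatou mu mD mf f0).
apply: ge0_le_integral => //; rewrite /limn_einf.
apply: measurableT_comp => //; apply: measurable_fun_limn_esup => k.
exact: measurableT_comp.
Qed.

(** Approaching [p] strictly from the right keeps the exponents inside an open
    interval with left end [p], and their rationality makes the family of all
    exponents met countable. *)
Lemma rat_seq_cvg_right (R : realType) (p q : R) : p < q ->
  exists2 u : nat -> rat, (forall k, p < ratr (u k) < q) &
    ratr (u k) @[k --> \oo] --> p.
Proof.
move=> pq.
have /choice[u uP] (k : nat) :
    exists r : rat, p < ratr r < Num.min q (p + harmonic k).
  have /rat_in_itvoo[r] : p < Num.min q (p + harmonic k).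
    by rewrite lt_min pq ltrDl harmonic_gt0.
  by rewrite in_itv/=; exists r.
exists u => [k|]; first by have /andP[-> /=] := uP k; rewrite lt_min => /andP[].
apply: (@squeeze_cvgr _ _ _ _ (cst p) (fun k => p + harmonic k)).
- apply: nearW => k /=; have /andP[/ltW -> /=] := uP k.
  by rewrite lt_min => /andP[_ /ltW].
- exact: cvg_cst.
- rewrite -[X in _ --> X]addr0.
  by apply: cvgD; [exact: cvg_cst|exact: cvg_harmonic].
Qed.

(** * Integrals of a family of kernels indexed by an exponent *)

Section kernel_family.
Context d1 d2 (X : measurableType d1) (Y : measurableType d2) (R : realType).
Variables (mu : {measure set X -> \bar R}).
Variables (nu : {sigma_finite_measure set Y -> \bar R}).
Variables (A : set X) (B : set Y) (mA : measurable A) (mB : measurable B).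
Variable K : R -> X -> Y -> R.
Hypothesis K_ge0 : forall p x y, 0 <= K p x y.
Hypothesis mK : forall p, measurable_fun (A `*` B) (fun z => K p z.1 z.2).
Hypothesis K_continuous : forall (p : R) x y, 0 < p ->
  {for p, continuous (fun r => K r x y)}.
Hypothesis K_le : forall p q x y, 1 <= p <= q -> K p x y <= K 1 x y + K q x y.

Let I p x : \bar R := (\int[nu]_(y in B) (K p x y)%:E)%E.

Let I_ge0 p x : (0 <= I p x)%E.
Proof. by apply: integral_ge0 => y _; rewrite lee_fin. Qed.

Let measurable_section p x : A x -> measurable_fun B (fun y => (K p x y)%:E).
Proof.
move=> Ax; apply/measurable_EFinP => _ Y' mY'.
have mAB : measurable (A `*` B) by exact: measurableX.
have := pair1_measurable x measurableT (mK p mAB mY').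
rewrite setTI; congr measurable; apply/seteqP; split => y /=.
  by move=> [[]].
by move=> [].
Qed.

(** Tonelli's theorem needs a kernel on the whole product: extend by zero
    outside of [A `*` B]. *)
Let measurable_I p : measurable_fun A (I p).
Proof.
pose f : X * Y -> \bar R := (EFin \o (fun z => K p z.1 z.2)) \_ (A `*` B).
have mAB : measurable (A `*` B) by exact: measurableX.
have mf : measurable_fun setT f.
  apply: (measurable_restrictT _ mAB).1.
  by apply/measurable_EFinP; exact: mK.
have f0 z : (0 <= f z)%E by apply: erestrict_ge0 => ? _; rewrite lee_fin.
have mF := @measurable_fun_fubini_tonelli_F _ _ _ _ _ nu _ mf f0.
apply: eq_measurable_fun (measurable_funTS mF) => x /[!inE] Ax.
rewrite /fubini_F /I [RHS]integral_mkcond; apply: eq_integral => y _.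
rewrite /f !patchE /= in_setX /=.
by rewrite (mem_set Ax).
Qed.

(** Lower semicontinuity of the integral in the exponent, by Fatou's lemma
    in [y]. *)
Let I_lsc (p : R) x (u : nat -> R) : A x -> 0 < p ->
  u k @[k --> \oo] --> p -> (I p x <= limn_einf (fun k => I (u k) x))%E.
Proof.
move=> Ax p0 up; apply: le_fatou => //.
- by move=> k; exact: measurable_section.
- by move=> k y _; rewrite lee_fin.
- exact: measurable_section.
- by move=> y _; rewrite lee_fin.
- move=> y By.
  have : (K (u k) x y)%:E @[k --> \oo] --> (K p x y)%:E.
    apply: cvg_EFin; first exact: nearW.
    by have := cvg_comp _ _ up (@K_continuous _ x y p0).
  by move=> /cvg_limn_einf_sup[-> _].
Qed.

Let I_le p q x : A x -> 1 <= p <= q -> (I p x <= I 1 x + I q x)%E.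
Proof.
move=> Ax pq; rewrite -ge0_integralD//; last 4 first.
- by move=> y _; rewrite lee_fin.
- exact: measurable_section.
- by move=> y _; rewrite lee_fin.
- exact: measurable_section.
apply: ge0_le_integral => //.
- by move=> y _; rewrite lee_fin.
- exact: measurable_section.
- by apply: emeasurable_funD; exact: measurable_section.
- by move=> y _; rewrite -EFinD lee_fin K_le.
Qed.

Let S q x := ereal_sup [set I p x | p in `]1, q[].

Let S_ge0 q : 1 < q -> forall x, (0 <= S q x)%E.
Proof.
move=> q1 x; apply: (le_trans (I_ge0 ((1 + q) / 2) x)).
apply: ereal_sup_ubound; exists ((1 + q) / 2) => //=.
by rewrite in_itv/= !midf_lt.
Qed.

(** By lower semicontinuity the supremum over [`]1, q[] equals the supremum over
    its rational points, hence over a sequence. *)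
Let measurable_S q : 1 < q -> measurable_fun A (S q).
Proof.
move=> q1.
(* Codes that stand for no rational of the interval get the value 0, which
   does not change the supremum of nonnegative values. *)
pose f m x : \bar R := if unpickle m is Some r then
  if 1 < (ratr r : R) < q then I (ratr r) x else 0%E else 0%E.
have mf m : measurable_fun A (f m).
  rewrite /f; case: unpickle => [r|]; last exact: measurable_cst.
  by case: (1 < ratr r < q); [exact: measurable_I|exact: measurable_cst].
have := measurable_fun_esups mf 0%N.
apply: eq_measurable_fun => x /[!inE] Ax.
apply/eqP; rewrite eq_le; apply/andP; split.
  apply: ge_ereal_sup => _ [m _ <-]; rewrite /f.
  have S0 := S_ge0 q1 x; case: unpickle => [r|//].
  have [rq|//] := boolP (1 < ratr r < q).
  by apply: ereal_sup_ubound; exists (ratr r) => //=; rewrite in_itv.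
apply: ge_ereal_sup => y [p /=]; rewrite in_itv/= => /andP[p1 pq] <-.
have [u uP up] := rat_seq_cvg_right pq.
have p0 : 0 < p by exact: lt_trans p1.
apply: le_trans (I_lsc Ax p0 up) _; apply: limn_einf_le.
move=> k; apply: ereal_sup_ubound; exists (pickle (u k)) => //=.
by rewrite /f pickleK; have /andP[pu ->] := uP k; rewrite (lt_trans p1).
Qed.

(** Fatou's lemma is used twice for the second implication: in [y], through the
    lower semicontinuity at the exponent 1, and in [x] along a sequence of
    exponents decreasing to 1. The third implication is the domination of the
    supremum by [I 1 + I q]. *)
Theorem sup_integrable_tfae :
  [<-> exists2 q : R, 1 < q & mu.-integrable A (S q);
       exists2 q : R, 1 < q &
         (ereal_sup [set \int[mu]_(x in A) I p x | p in `]1%R, q[%classic]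
            < +oo)%E;
       exists2 q : R, 1 < q &
         mu.-integrable A (I 1) /\ mu.-integrable A (I q)].
Proof.
tfae.
- move=> [q q1 /integrableP[mS Soo]]; exists q => //.
  apply: le_lt_trans Soo; apply: ge_ereal_sup => _ [p pq <-].
  apply: ge0_le_integral => //; first exact: measurableT_comp.
  move=> x Ax; rewrite (le_trans _ (lee_abs _))//.
  by apply: ereal_sup_ubound; exists p.
- move=> [q q1]; set M := ereal_sup _ => Moo.
  have le_sup p : 1 < p < q -> (\int[mu]_(x in A) I p x <= M)%E.
    by move=> pq; apply: ereal_sup_ubound; exists p => //=; rewrite in_itv.
  have I_integrable p : (\int[mu]_(x in A) I p x <= M)%E ->
      mu.-integrable A (I p).
    move=> Ip; apply/integrableP; split => //; apply: le_lt_trans Moo.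
    by under eq_integral do rewrite gee0_abs//.
  exists ((1 + q) / 2); first by rewrite midf_lt.
  split; last by apply/I_integrable/le_sup; rewrite !midf_lt.
  apply: I_integrable.
  have [u uP up] := rat_seq_cvg_right q1.
  apply: le_trans (limn_einf_le (fun k => le_sup _ (uP k))).
  by apply: le_fatou => // x Ax; exact: I_lsc up.
- move=> [q q1 [I1 Iq]]; exists q => //.
  apply: (le_integrable mA (measurable_S q1) _ (integrableD mA I1 Iq)) => x Ax.
  have I1q : (0 <= I 1 x + I q x)%E by rewrite adde_ge0.
  rewrite (gee0_abs (S_ge0 q1 x)) [leRHS]gee0_abs//.
  apply: ge_ereal_sup => y [p /=].
  rewrite in_itv/= => /andP[p1 pq] <-.
  by apply: I_le => //; rewrite !ltW.
Qed.
End kernel_family.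

(** * The integrand of the tail as a function of the exponent *)

Section power_kernel.
Context {R : realType}.
Implicit Types a d c s p q : R.

(** For [a = 0] the function is the indicator of [0], so continuity fails at the
    exponent [0] alone. *)
Lemma continuous_powRr a p : p != 0 -> {for p, continuous (powR a)}.
Proof.
move=> p0; have [->|a0] := eqVneq a 0.
  have : \forall r \near p, 0 = 0 `^ r.
    by near=> r; rewrite powR0//; near: r; exact: open_neq.
  move=> /near_eq_cvg e; rewrite /prop_for /continuous_at powR0//.
  apply: cvg_trans e _.
  exact: cvg_cst.
rewrite (_ : powR a = fun r => expR (r * ln a)); last first.
  by apply/funext => r; rewrite /powR (negbTE a0).
apply: (@continuous_comp _ _ _ (fun r : R => r * ln a) expR).
  by apply: cvgM; [exact: cvg_id|exact: cvg_cst].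
exact: continuous_expR.
Unshelve. all: by end_near. Qed.

(** For [a >= 0] and [d > 0] this is [(a / d ^ s) ^ p / d ^ c]. *)
Definition power_kernel c s a d p : R := a `^ p / d `^ (c + s * p).

Lemma power_kernel_ge0 c s a d p : 0 <= power_kernel c s a d p.
Proof. by rewrite divr_ge0// powR_ge0. Qed.

Lemma continuous_power_kernel c s a d p : 0 <= c -> 0 < s -> 0 < p ->
  {for p, continuous (power_kernel c s a d)}.
Proof.
move=> c0 s0 p0.
rewrite (_ : power_kernel c s a d = fun r => a `^ r * d `^ (- (c + s * r))).
  apply: cvgM; first by apply: continuous_powRr; rewrite gt_eqF.
  apply: (@continuous_comp _ _ _ (fun r => - (c + s * r)) (powR d)).
    apply: cvgN; apply: cvgD; first exact: cvg_cst.
    by apply: cvgM; [exact: cvg_cst|exact: cvg_id].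
  by apply: continuous_powRr; rewrite oppr_eq0 gt_eqF// ltr_wpDl// mulr_gt0.
by apply/funext => r; rewrite powRN.
Qed.

(** Away from the degenerate cases the kernel is [expR (p * L - M)] with [L] and
    [M] independent of [p], and [p * L] is at most [L] or [q * L] according to
    the sign of [L]. *)
Lemma power_kernel_le c s a d p q : 0 <= c -> 0 < s -> 1 <= p <= q ->
  power_kernel c s a d p <= power_kernel c s a d 1 + power_kernel c s a d q.
Proof.
move=> c0 s0 /andP[p1 pq]; have p0 : 0 < p by exact: lt_le_trans p1.
have [->|a0] := eqVneq a 0.
  rewrite {1}/power_kernel powR0 ?mul0r ?gt_eqF//.
  by rewrite addr_ge0// power_kernel_ge0.
have [->|d0] := eqVneq d 0.
  rewrite {1}/power_kernel (@powR0 _ (c + _)).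
    by rewrite invr0 mulr0 addr_ge0// power_kernel_ge0.
  by rewrite gt_eqF// ltr_wpDl// mulr_gt0.
have kE r : power_kernel c s a d r = expR (r * (ln a - s * ln d) - c * ln d).
  rewrite /power_kernel -powRN /powR (negbTE a0) (negbTE d0) -expRD.
  by congr expR; ring.
rewrite !kE; set L := ln a - _.
have [L0|L0] := leP 0 L.
  rewrite (@le_trans _ _ (expR (q * L - c * ln d)))//.
    by rewrite ler_expR lerD2r ler_wpM2r.
  by rewrite lerDr expR_ge0.
rewrite (@le_trans _ _ (expR (1 * L - c * ln d)))//.
  by rewrite ler_expR lerD2r ler_wnM2r// ltW.
by rewrite lerDl expR_ge0.
Qed.
End power_kernel.

(** * Measurability for the Lebesgue sigma-algebra *)

Lemma open_rV_bigcup_ball (R : realType) n (A : set 'rV[R]_n) : open A ->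
  A = \bigcup_(cq in [set cq : 'rV[rat]_n * nat |
        ball (map_mx ratr cq.1 : 'rV[R]_n) cq.2.+1%:R^-1 `<=` A])
      ball (map_mx ratr cq.1 : 'rV[R]_n) cq.2.+1%:R^-1.
Proof.
move=> oA; apply/seteqP; split => [x Ax|x [cq + xcq]]; last exact.
move: oA; rewrite openE => /(_ _ Ax)/nbhs_ballP[e /= e0 eA].
(* With a radius below [e / 2], a ball that contains [x] lies in the ball of
   radius [e] around [x]. *)
have [k ke] : exists k : nat, k.+1%:R^-1 < e / 2.
  have : \forall k \near \oo, harmonic k < e / 2.
    by apply: (cvgr_lt _ (@cvg_harmonic R)); rewrite divr_gt0.
  by move=> [k _ /(_ k (leqnn k))]; exists k.
have k0 : 0 < k.+1%:R^-1 :> R by [].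
have /choice[c cP] (i : 'I_n) :
    exists r : rat, x ord0 i < ratr r < x ord0 i + k.+1%:R^-1.
  have /rat_in_itvoo[r] : x ord0 i < x ord0 i + k.+1%:R^-1 by rewrite ltrDl.
  by rewrite in_itv/=; exists r.
have cx : ball (map_mx ratr (\row_i c i) : 'rV[R]_n) k.+1%:R^-1 x.
  split => // i j; rewrite !mxE (ord1 i) /ball/=.
  have /andP[xc cx] := cP j.
  by rewrite gtr0_norm ?subr_gt0// ltrBlDl.
exists (\row_i c i, k) => //= y cy; apply: eA.
apply: (@le_ball _ _ x (k.+1%:R^-1 + k.+1%:R^-1)).
  by rewrite [leRHS]splitr; apply/ltW; rewrite ltrD.
by apply: ball_triangle cy; exact: ball_sym.
Qed.

Section lebesgue_space.
Context (R : realType) (n : nat).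
Local Notation L := (lebesgue_space R n).

Lemma measurable_lebesgue_coord (i : 'I_n) :
  measurable_fun [set: L] (fun x : L => (x : 'rV[R]_n) ord0 i).
Proof.
move=> _ Y mY; rewrite setTI; apply: sub_caratheodory.
apply: sub_sigma_algebra; rewrite -[X in measurable X]setTI.
exact: (@measurable_rV_coord _ (measurableTypeR R)).
Qed.

(** A ball of the sup norm is a finite intersection of preimages of intervals
    under the coordinates. *)
Lemma open_lebesgue_measurable (A : set 'rV[R]_n) :
  open A -> measurable (A : set L).
Proof.
move=> /open_rV_bigcup_ball ->.
set P := (X in \bigcup_(_ in X) _).
rewrite bigcup_mkcond; apply: countable_bigcupT_measurable => // -[c k].
case: ifP => // _.
rewrite (_ : ball _ _ = \bigcap_(i in [set: 'I_n])
    [set x : L | ball (ratr (c ord0 i) : R) k.+1%:R^-1 ((x : 'rV[R]_n) ord0 i)]).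
  apply: fin_bigcap_measurable => // i _.
  rewrite -[X in measurable X]setTI.
  apply: (measurable_lebesgue_coord i measurableT (Y := ball _ _)).
  exact: measurable_ball.
apply/seteqP; split => x /=.
  by move=> [_ xc] i _; have := xc ord0 i; rewrite mxE.
move=> xc; split; first by rewrite invr_gt0.
by move=> i j; rewrite (ord1 i) mxE; exact: xc.
Qed.

Lemma measurable_enormB :
  measurable_fun [set: L * L]
    (fun z : L * L => enorm ((z.1 : 'rV[R]_n) - z.2)).
Proof.
apply: (measurableT_comp (@continuous_measurable_fun R _ (@sqrt_continuous R))).
apply: measurable_sum => i; apply: measurable_funX.
under eq_fun do rewrite !mxE.
apply: measurable_funB.
  exact: (measurableT_comp (measurable_lebesgue_coord i) measurable_fst).
exact: (measurableT_comp (measurable_lebesgue_coord i) measurable_snd).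
Qed.

End lebesgue_space.

(** * The equivalence for tails *)

Lemma Lnorm1_restrict d (T : measurableType d) (R : realType)
    (mu : {measure set T -> \bar R}) (D : set T) (f : T -> \bar R) :
  (forall x, D x -> (0 <= f x)%E) ->
  ('N[mu]_1[f \_ D] = \int[mu]_(x in D) f x)%E.
Proof.
move=> f0; rewrite Lnorm1 [RHS]integral_mkcond.
by apply: eq_integral => x _; rewrite gee0_abs// erestrict_ge0.
Qed.

Lemma measurable_tail_integrand (R : realType) n (A B : set 'rV[R]_n)
    (phi : 'rV[R]_n -> R) (c s p : R) :
  measurable (A : set (lebesgue_space R n)) ->
  measurable (B : set (lebesgue_space R n)) ->
  measurable_fun (B : set (lebesgue_space R n)) phi ->
  measurable_fun (A `*` B : set (lebesgue_space R n * lebesgue_space R n))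
    (fun z => power_kernel c s `|phi z.2| (enorm ((z.1 : 'rV[R]_n) - z.2)) p).
Proof.
move=> mA mB mphi; have mAB := measurableX mA mB.
have mphi2 : measurable_fun
    (A `*` B : set (lebesgue_space R n * lebesgue_space R n))
    (fun z => phi z.2).
  apply: (measurable_comp mB _ mphi).
    by move=> _ [z [_ Bz] <-].
  exact: (measurable_funTS measurable_snd).
apply: measurable_funM.
  apply: (measurableT_comp (@measurable_powR R p)).
  exact: (measurableT_comp (@normr_measurable R setT) mphi2).
under eq_fun do rewrite -powRN.
apply: (measurableT_comp (@measurable_powR R _)).
exact: measurable_funTS (@measurable_enormB R n).
Qed.

Theorem lemma1p9 (R : realType) (n : nat) (Omega : set 'rV[R]_n) (s : R)
    (phi : 'rV[R]_n -> R)
    (Omega_open : open Omega) (Omega_bounded : bounded_set Omega)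
    (Omega_lipschitz : lipschitz_boundary Omega)
    (s_gt0 : 0 < s) (s_lt1 : s < 1)
    (phi_measurable :
       measurable_fun (~` Omega : set (lebesgue_space R n)) phi) :
  [<-> exists2 q : R, 1 < q &
         lebesgue_rV.-integrable Omega
           (fun x => ereal_sup [set Tail s p phi (~` Omega) x | p in `]1, q[]);
       exists2 q : R, 1 < q &
         (ereal_sup [set 'N[lebesgue_rV]_1[Tail s p phi (~` Omega) \_ Omega]
                    | p in `]1%R, q[%classic] < +oo)%E;
       exists2 q : R, 1 < q &
         lebesgue_rV.-integrable Omega (Tail s 1 phi (~` Omega)) /\
         lebesgue_rV.-integrable Omega (Tail s q phi (~` Omega))].
Proof.
have mOmega := open_lebesgue_measurable Omega_open.
have mC : measurable (~` Omega : set (lebesgue_space R n)).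
  exact: measurableC.
pose K p (x y : lebesgue_space R n) :=
  power_kernel n%:R s `|phi y| (enorm ((x : 'rV[R]_n) - y)) p.
have NE : (fun p => 'N[lebesgue_rV]_1[Tail s p phi (~` Omega) \_ Omega])%E =
    (fun p => \int[lebesgue_rV]_(x in Omega) Tail s p phi (~` Omega) x)%E.
  apply/funext => p; apply: Lnorm1_restrict => x _; apply: integral_ge0 => y _.
  by rewrite lee_fin power_kernel_ge0.
rewrite NE.
apply: (sup_integrable_tfae lebesgue_rV lebesgue_rV mOmega mC (K := K)).
- by move=> p x y; exact: power_kernel_ge0.
- by move=> p; exact: measurable_tail_integrand.
- by move=> p x y p0; exact: continuous_power_kernel.
- by move=> p q x y pq; exact: power_kernel_le.
Qed.
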